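(* Let $(\mathcal{A},\rightarrow)$ be an abstract reduction system, $\mathcal{D}\subseteq\mathcal{A}$, and define the equivalence $\sim$ on $\mathcal{A}$ by $x\sim y$ exactly when $x=y$ or $x,y\in\mathcal{A}\setminus\mathcal{D}$. Let $\mathcal{P}$ be one of the properties confluence, local confluence, or subcommutativity. Then: (1) if $\mathcal{A}\setminus\mathcal{D}$ is closed under $\rightarrow$ and $\rightarrow$ is $\mathcal{P}$ up to garbage on $\mathcal{D}$, then $\rightarrow$ is $\mathcal{P}$ modulo $\sim$; (2) if $\mathcal{D}$ is closed under $\rightarrow$ and $\rightarrow$ is $\mathcal{P}$ modulo $\sim$, then $\rightarrow$ is $\mathcal{P}$ up to garbage on $\mathcal{D}$.
   Context: An abstract reduction system is a pair $(\mathcal{A},\rightarrow)$ with $\mathcal{A}$ a class and $\rightarrow$ a binary relation on $\mathcal{A}$; $\xrightarrow{=}$ and $\xrightarrow{*}$ are its reflexive and reflexive transitive closures. A subclass $\mathcal{C}\subseteq\mathcal{A}$ is closed under $\rightarrow$ if $x\in\mathcal{C}$ and $x\rightarrow y$ imply $y\in\mathcal{C}$. Elements $y_1,y_2$ are joinable if $y_1\xrightarrow{*}z\xleftarrow{*}y_2$ for some $z$, subcommutative if $y_1\xrightarrow{=}z\xleftarrow{=}y_2$ for some $z$. Up to garbage on $\mathcal{D}$: $\rightarrow$ is confluent (resp. locally confluent, subcommutative) up to garbage on $\mathcal{D}$ if for all $x\in\mathcal{D}$, $y_1\xleftarrow{*}x\xrightarrow{*}y_2$ implies $y_1,y_2$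 joinable (resp. $y_1\leftarrow x\rightarrow y_2$ implies joinable, resp. subcommutative). Modulo an equivalence $\sim$: $y_1,y_2$ are $\sim$-joinable if there are $z_1\sim z_2$ with $y_1\xrightarrow{*}z_1$, $y_2\xrightarrow{*}z_2$, and $\sim$-subcommutative if there are $z_1\sim z_2$ with $y_1\xrightarrow{=}z_1$, $y_2\xrightarrow{=}z_2$; $\rightarrow$ is confluent modulo $\sim$ if for all $x\in\mathcal{A}$, $y_1\xleftarrow{*}x\xrightarrow{*}y_2$ implies $y_1,y_2$ are $\sim$-joinable; locally confluent modulo $\sim$ if $y_1\leftarrow x\rightarrow y_2$ implies $\sim$-joinable; subcommutative modulo $\sim$ if $y_1\leftarrow x\rightarrow y_2$ implies $\sim$-subcommutative. *)

(* Defs.v *)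
From Stdlib Require Import Relations.

Section AbstractReduction.

Variables (A : Type) (R : relation A).

Definition subclass := A -> Prop.

Definition complement (D : subclass) : subclass := fun x => ~ D x.

Definition closed_under (C : subclass) : Prop :=
  forall x y, C x -> R x y -> C y.

Definition joinable (y1 y2 : A) : Prop :=
  exists z, clos_refl_trans A R y1 z /\ clos_refl_trans A R y2 z.

Definition subcommutative_pair (y1 y2 : A) : Prop :=
  exists z, clos_refl A R y1 z /\ clos_refl A R y2 z.

Definition confluent_up_to_garbage (D : subclass) : Prop :=
  forall x y1 y2, D x -> clos_refl_trans A R x y1 -> clos_refl_trans A R x y2 ->
    joinable y1 y2.

Definition locally_confluent_up_to_garbage (D : subclass) : Prop :=
  forall x y1 y2, D x -> R x y1 -> R x y2 -> joinable y1 y2.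

Definition subcommutative_up_to_garbage (D : subclass) : Prop :=
  forall x y1 y2, D x -> R x y1 -> R x y2 -> subcommutative_pair y1 y2.

Definition joinable_mod (E : relation A) (y1 y2 : A) : Prop :=
  exists z1 z2,
    E z1 z2 /\ clos_refl_trans A R y1 z1 /\ clos_refl_trans A R y2 z2.

Definition subcommutative_pair_mod (E : relation A) (y1 y2 : A) : Prop :=
  exists z1 z2, E z1 z2 /\ clos_refl A R y1 z1 /\ clos_refl A R y2 z2.

Definition confluent_modulo (E : relation A) : Prop :=
  forall x y1 y2, clos_refl_trans A R x y1 -> clos_refl_trans A R x y2 ->
    joinable_mod E y1 y2.

Definition locally_confluent_modulo (E : relation A) : Prop :=
  forall x y1 y2, R x y1 -> R x y2 -> joinable_mod E y1 y2.

Definition subcommutative_modulo (E : relation A) : Prop :=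
  forall x y1 y2, R x y1 -> R x y2 -> subcommutative_pair_mod E y1 y2.

Definition garbage_equiv (D : subclass) : relation A :=
  fun x y => x = y \/ (complement D x /\ complement D y).

Lemma garbage_equiv_equivalence (D : subclass) :
  equivalence A (garbage_equiv D).
Proof.
  split.
  - intros x; now left.
  - intros x y z [-> | [Hx Hy]] [<- | [Hy' Hz]]; unfold garbage_equiv; tauto.
  - intros x y [-> | [Hx Hy]]; unfold garbage_equiv; tauto.
Qed.

Inductive ars_property : Set :=
  | Confluence
  | LocalConfluence
  | Subcommutativity.

Definition up_to_garbage (P : ars_property) : subclass -> Prop :=
  match P with
  | Confluence => confluent_up_to_garbage
  | LocalConfluence => locally_confluent_up_to_garbage
  | Subcommutativity => subcommutative_up_to_garbage
  end.

Definition modulo (P : ars_property) : relation A -> Prop :=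
  match P with
  | Confluence => confluent_modulo
  | LocalConfluence => locally_confluent_modulo
  | Subcommutativity => subcommutative_modulo
  end.

End AbstractReduction.

Arguments complement {A} D x /.
Arguments closed_under {A} R C.
Arguments garbage_equiv {A} D x y.
Arguments up_to_garbage {A} R P D.
Arguments modulo {A} R P E.

(* Main.v *)
Require Import Defs.
From Stdlib Require Import Relations Classical.

Lemma closed_under_clos_refl_trans (A : Type) (R : relation A) (C : subclass A) :
  closed_under R C -> closed_under (clos_refl_trans A R) C.
Proof. intros HC x y Hx Hxy; induction Hxy; eauto. Qed.

Lemma closed_under_clos_refl (A : Type) (R : relation A) (C : subclass A) :
  closed_under R C -> closed_under (clos_refl A R) C.
Proof. intros HC x y Hx [z Hxz |]; eauto. Qed.

(** Membership of one side suffices, since the garbage disjunct would put [x] outside [D]. *)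
Lemma garbage_equiv_eq (A : Type) (D : subclass A) (x y : A) :
  D x -> garbage_equiv D x y -> x = y.
Proof. intros Hx [Hxy | [Hnx _]]; [exact Hxy | contradiction]. Qed.

(* A peak whose source is garbage has both of its ends in garbage, so they are
   already equivalent; a peak with source in [D] stays in [D] when [D] is
   closed, and there the equivalence is equality. *)
Theorem mainTheorem4 (A : Type) (R : relation A) (D : subclass A)
  (P : ars_property) :
  (closed_under R (complement D) -> up_to_garbage R P D ->
     modulo R P (garbage_equiv D)) /\
  (closed_under R D -> modulo R P (garbage_equiv D) ->
     up_to_garbage R P D).
Proof.
  split; intros HC HP.
  - pose proof (closed_under_clos_refl_trans A R _ HC) as HC'.
    destruct P; intros x y1 y2 H1 H2; destruct (classic (D x)) as [Hx | Hx].
    (* These are the goals with [D x], one per property: the common reduct [z] serves as both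
       witnesses. *)
    1, 3, 5: destruct (HP x y1 y2 Hx H1 H2) as (z & Hz1 & Hz2);
      exists z, z; split; [left; reflexivity | split; assumption].
    (* From a garbage source no further reduction is needed: the ends of the peak are the witnesses,
       reached in zero steps. *)
    + exists y1, y2; split; [right; split; eapply HC'; eassumption |].
      split; apply rt_refl.
    + exists y1, y2; split; [right; split; eapply HC; eassumption |].
      split; apply rt_refl.
    + exists y1, y2; split; [right; split; eapply HC; eassumption |].
      split; apply r_refl.
  - pose proof (closed_under_clos_refl_trans A R _ HC) as HC'.
    pose proof (closed_under_clos_refl A R _ HC) as HCr.
    destruct P; intros x y1 y2 Hx H1 H2;
      destruct (HP x y1 y2 H1 H2) as (z1 & z2 & Hz & Hz1 & Hz2);
      (* [D z1] follows by pushing [D] along [x], [y1], [z1], with [HC], [HC'] or [HCr] according to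
         the kind of reduction in each leg. *)
      assert (z1 = z2) as <- by (apply (garbage_equiv_eq A D); eauto);
      exists z1; split; assumption.
Qed.
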